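(* Given integers $n, k \geq 1$ and a complex matrix $C \in \mathbb{C}^{k \times n}$, let $J \subset \{1, \dots, n\}$ index the nonzero columns of $C$. Then for all integers $a \geq 1$ and matrices $A, B \in \mathbb{C}^{n \times a}$ such that $(A A^* )_{J \times J}$ and $(B B^* )_{J \times J}$ are nonzero, we have the (rank $\leq 1$) lower bound $$C (A A^* \circ B B^* ) C^* \ \geq \ \gamma(A,B,J) \cdot C\, d_{A B^T}\, d_{A B^T}^*\, C^*,$$ where the following choice of scalar $\gamma(A,B,J)$ is best possible: $$\gamma(A,B,J) := \frac{1}{\min(\operatorname{rk}\,(A A^* )_{J \times J},\ \operatorname{rk}\,(B B^* )_{J \times J})}.$$
   Context: For complex matrices $X=(x_{jk})$, $Y=(y_{jk})$ of the same size, the Schur (entrywise) product $X \circ Y$ has $(j,k)$ entry $x_{jk} y_{jk}$. For square complex matrices $X, Y$ of the same size, $X \geq Y$ (Loewner ordering) means that $X - Y$ is positive semidefinite, i.e. Hermitian with non-negative eigenvalues. For a square matrix $M = (m_{jk}) \in \mathbb{C}^{n\times n}$, $d_M := (m_{11}, \dots, m_{nn})^T$ denotes the column vector of its diagonal entries, and for $J \subset \{1,\dots,n\}$, $M_{J \times J}$ denotes the principal submatrix of $M$ with rows and columns indexed by $J$. $X^T$ is the transpose (no conjugation) and $X^*$ the conjugate transpose; $\operatorname{rk}$ denotes rank. *)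

(* Defs.v *)
From HB Require Import structures.
From mathcomp Require Import all_boot all_order all_algebra.
From mathcomp Require Import complex.
From mathcomp Require Import reals.

Set Implicit Arguments.
Unset Strict Implicit.
Unset Printing Implicit Defensive.

Import Order.TTheory GRing.Theory Num.Theory Num.Def.

Local Open Scope ring_scope.
Local Open Scope sesquilinear_scope.

Section Definitions.
Variable R : realType.

Definition schur_prod (m n : nat) (X Y : 'M[R[i]]_(m, n)) : 'M[R[i]]_(m, n) :=
  map2_mx *%R X Y.

(* The order on R[i] is such that 0 <= z means that z is real and
   nonnegative. *)
Definition psdmx (n : nat) (M : 'M[R[i]]_n) : Prop :=
  M \is hermsymmx /\ (forall z : R[i], eigenvalue M z -> 0 <= z).

Definition loewner_ge (n : nat) (X Y : 'M[R[i]]_n) : Prop := psdmx (X - Y).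

Definition diag_col (n : nat) (M : 'M[R[i]]_n) : 'cV[R[i]]_n :=
  \col_i M i i.

Definition principal_submx (n : nat) (J : {set 'I_n}) (M : 'M[R[i]]_n) :
    'M[R[i]]_#|J| :=
  mxsub enum_val enum_val M.

Definition nonzero_cols (k n : nat) (C : 'M[R[i]]_(k, n)) : {set 'I_n} :=
  [set j | col j C != 0].

Definition gram_on (n a : nat) (J : {set 'I_n}) (A : 'M[R[i]]_(n, a)) :
    'M[R[i]]_#|J| :=
  principal_submx J (A *m A ^t conjC).

Definition schur_lhs (k n a : nat) (C : 'M[R[i]]_(k, n))
    (A B : 'M[R[i]]_(n, a)) : 'M[R[i]]_k :=
  C *m schur_prod (A *m A ^t conjC) (B *m B ^t conjC) *m C ^t conjC.

Definition schur_rhs (k n a : nat) (C : 'M[R[i]]_(k, n))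
    (A B : 'M[R[i]]_(n, a)) : 'M[R[i]]_k :=
  let d := diag_col (A *m B^T) in
  C *m d *m d ^t conjC *m C ^t conjC.

Definition gamma (n a : nat) (A B : 'M[R[i]]_(n, a)) (J : {set 'I_n}) : R[i] :=
  (minn (\rank (gram_on J A)) (\rank (gram_on J B)))%:R^-1.

End Definitions.

(* Main.v *)
(** Testing the inequality on a row vector [v], with [x := v C] (which vanishes
    off [J]) and [M := B^T diag(x) A], the left-hand side becomes the squared
    Frobenius norm [|M|_F^2] and the right-hand side [gamma |tr M|^2]. As [M] only
    involves the rows of [A] and [B] in [J], its rank is at most the
    minimum of the two ranks, and [|tr M|^2 <= rk M * |M|_F^2]. Equality
    holds when [M] is an orthogonal projection; choosing [v] so that [x] has no
    zero entry on [J], one can solve for [A] and [B] of the prescribed ranks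
    making [M] a coordinate projection of rank [min (p, q)]. *)

Require Import Defs.
From HB Require Import structures.
From mathcomp Require Import all_boot all_order all_algebra.
From mathcomp Require Import complex.
From mathcomp Require Import reals.
From mathcomp Require Import zify.
Import Order.TTheory GRing.Theory Num.Theory.
Local Open Scope ring_scope.

Set Implicit Arguments.
Unset Strict Implicit.
Unset Printing Implicit Defensive.

Local Open Scope sesquilinear_scope.

(** * Frobenius norm, rank and positive semidefiniteness *)

Section ConjugateTranspose.
Variable K : numClosedFieldType.

Lemma adjmx_mul m n p (A : 'M[K]_(m, n)) (B : 'M[K]_(n, p)) :
  (A *m B)^t* = B^t* *m A^t*.
Proof. by rewrite trmx_mul map_mxM. Qed.

Lemma adjmx_subZ m n c (A B : 'M[K]_(m, n)) :
  (A - c *: B)^t* = A^t* - c^* *: B^t*.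
Proof. by rewrite linearB linearZ /= map_mxB map_mxZ. Qed.

Lemma mxtrace_adj n (A : 'M[K]_n) : \tr (A^t*) = (\tr A)^*.
Proof. by rewrite trace_map_mx mxtrace_tr. Qed.

Lemma mxtrace_gramE m n (A : 'M[K]_(m, n)) :
  \tr (A *m A^t*) = \sum_i \sum_j `|A i j| ^+ 2.
Proof.
apply: eq_bigr => i _; rewrite mxE.
by apply: eq_bigr => j _; rewrite !mxE normCK.
Qed.

Lemma mxtrace_gram_ge0 m n (A : 'M[K]_(m, n)) : 0 <= \tr (A *m A^t*).
Proof.
by rewrite mxtrace_gramE; do 2![apply: sumr_ge0 => ? _]; rewrite exprn_ge0.
Qed.

Lemma mxtrace_gram_eq0 m n (A : 'M[K]_(m, n)) : (\tr (A *m A^t*) == 0) = (A == 0).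
Proof.
apply/eqP/eqP => [|->]; last by rewrite mul0mx mxtrace0.
rewrite mxtrace_gramE => A0; apply/matrixP => i j; rewrite mxE.
have rowA0 k : 0 <= \sum_l `|A k l| ^+ 2.
  by apply: sumr_ge0 => ? _; rewrite exprn_ge0.
have /eqP := A0; rewrite psumr_eq0 // => /allP/(_ i (mem_index_enum _)) /=.
rewrite psumr_eq0 => [/allP/(_ j (mem_index_enum _)) /=|l _]; last first.
  by rewrite exprn_ge0.
by rewrite sqrf_eq0 normr_eq0 => /eqP.
Qed.

(** A row basis [K] of the left kernel of [A *m A^t*] makes the Frobenius norm of [K *m A] vanish,
    so the two left kernels agree. *)
Lemma rank_gram m n (A : 'M[K]_(m, n)) : \rank (A *m A^t*) = \rank A.
Proof.
apply/eqP; rewrite eqn_leq mxrankM_maxl /=.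
have: (kermx (A *m A^t*) <= kermx A)%MS.
  apply/sub_kermxP/eqP; rewrite -mxtrace_gram_eq0 adjmx_mul mulmxA.
  by rewrite -[_ *m A *m _]mulmxA mulmx_ker mul0mx mxtrace0.
move/mxrankS; rewrite !mxrank_ker leq_sub2lE //.
exact: rank_leq_row.
Qed.

(** Cauchy-Schwarz for the Frobenius inner product of [M] with a projection of squared norm
    [\rank M]. *)
Lemma norm_mxtrace_sqr_le m (M : 'M[K]_m) :
  `|\tr M| ^+ 2 <= (\rank M)%:R * \tr (M *m M^t*).
Proof.
have [M0|r_gt0] := posnP (\rank M).
  rewrite M0 mul0r; move/eqP: M0; rewrite mxrank_eq0 => /eqP->.
  by rewrite mxtrace0 normr0 expr0n.
pose r : K := (\rank M)%:R.
have r0 : 0 < r by rewrite ltr0n.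
pose F := schmidt (row_base M).
have uF : F *m F^t* = 1%:M by apply/unitarymxP/schmidt_unitarymx/rank_leq_col.
(* [P] is the orthogonal projection onto the row space of [M]; the claim is
   [0 <= tr (N N^* )] for [N := M - (tr M / r) P]. *)
pose P := F^t* *m F.
have MP : M *m P = M.
  have /submxP[E ->] : (M <= F)%MS.
    by rewrite /F eqmx_schmidt_free ?row_base_free // eq_row_base.
  by rewrite -mulmxA [F *m P]mulmxA uF mul1mx.
have Pt : P^t* = P by rewrite adjmx_mul trmxCK.
have PMt : P *m M^t* = M^t* by rewrite -{1}Pt -adjmx_mul MP.
have PP : \tr (P *m P) = r.
  by rewrite /P mulmxA -[_ *m F *m F^t*]mulmxA uF mulmx1 mxtrace_mulC uF mxtrace1.
pose t := \tr M / r.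
have := mxtrace_gram_ge0 (M - t *: P).
rewrite adjmx_subZ Pt mulmxBl !mulmxBr -!scalemxAl -!scalemxAr MP PMt.
rewrite !(raddfB (@mxtrace _ _)) /= !mxtraceZ PP mxtrace_adj.
(* [t] is the coefficient of [M] along [P], so the residual is orthogonal to [P] and only
   [\tr (M *m M^t* ) - t^* * \tr M] survives. *)
have -> : t^* = (\tr M)^* / r by rewrite rmorphM fmorphV rmorph_nat.
rewrite divfK ?gt_eqF // subrr subr0 subr_ge0.
by rewrite mulrAC -normCKC ler_pdivrMr // mulrC.
Qed.

Lemma adjmx_hermitian n (M : 'M[K]_n) :
  M \is hermsymmx -> M^t* = M.
Proof. by move/is_hermitianmxP; rewrite expr0 scale1r. Qed.

(** Trades the spectral definition of [psdmx] for quadratic forms. Unitary diagonalisation writes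
    the form as a sum of eigenvalues times squared moduli; conversely, at an eigenvector the form is
    [z] times a positive number. *)
Lemma hermitian_eigen_ge0P n (M : 'M[K]_n) :
  (M \is hermsymmx /\ forall z, eigenvalue M z -> 0 <= z) <->
  (M^t* = M /\ forall v : 'rV_n, 0 <= (v *m M *m v^t*) 0 0).
Proof.
split=> [[hM eM]|[hM fM]]; last first.
  split=> [|z /eigenvalueP[v vM v0]].
    by apply/is_hermitianmxP; rewrite expr0 scale1r hM.
  have := fM v; rewrite vM -scalemxAl mxE -trace_mx11 pmulr_lge0 //.
  by rewrite lt_def mxtrace_gram_eq0 v0 mxtrace_gram_ge0.
split=> [|v]; first exact: adjmx_hermitian.
have /hermitian_normalmx/orthomx_spectralP := hM.
set P := spectralmx M; set d := spectral_diag M => defM.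
have uP : P \in unitmx := spectral_unit M.
have d_ge0 i : 0 <= d 0 i.
  (* Row [i] of [P] is an eigenvector for [d 0 i]. *)
  apply: eM; apply/eigenvalueP; exists (delta_mx 0 i *m P); last first.
    apply/eqP => /(congr1 (mulmx^~ (invmx P))); rewrite mulmxK // mul0mx.
    by move/matrixP/(_ 0 i)/eqP; rewrite !mxE !eqxx oner_eq0.
  rewrite {1}defM !mulmxA mulmxK // scalemxAl; congr (mulmx _ P).
  apply/matrixP => k j; rewrite mul_mx_diag !mxE.
  by case: (eqVneq j i) => [->|_]; rewrite ?andbF ?mul0r ?mulr0 // mulrC.
have -> : v *m M *m v^t* = (v *m P^t*) *m diag_mx d *m (v *m P^t*)^t*.
  by rewrite adjmx_mul trmxCK {1}defM invmx_unitary ?spectral_unitarymx // !mulmxA.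
rewrite mul_mx_diag mxE sumr_ge0 // => i _.
by rewrite !mxE mulrAC -normCK mulr_ge0 ?exprn_ge0.
Qed.

End ConjugateTranspose.

(** * Restriction to the rows indexed by [J] *)

Section Restriction.
Variable K : comNzRingType.

Definition rows_on n a (J : {set 'I_n}) (A : 'M[K]_(n, a)) : 'M[K]_(#|J|, a) :=
  rowsub enum_val A.

Definition sandwich n a (A B : 'M[K]_(n, a)) (x : 'rV[K]_n) : 'M[K]_a :=
  B^T *m diag_mx x *m A.

(** Factoring through the rows in [J] lets the ranks of the restrictions, not of [A] and [B], bound
    the rank of the product. *)
Lemma sandwich_rows_on n a (J : {set 'I_n}) (A B : 'M[K]_(n, a)) (x : 'rV[K]_n) :
  (forall i, i \notin J -> x 0 i = 0) ->
  sandwich A B x = sandwich (rows_on J A) (rows_on J B) (colsub enum_val x).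
Proof.
move=> x0; apply/matrixP => l m; rewrite /sandwich !mul_mx_diag !mxE.
rewrite (bigID [in J]) /= [X in _ + X]big1 ?addr0 => [|i iJ]; last first.
  by rewrite !mxE x0 // mulr0 mul0r.
by rewrite big_enum_val; apply: eq_bigr => i _; rewrite !mxE.
Qed.

End Restriction.

(** * Row vectors avoiding zeros on the nonzero columns *)

Lemma exists_nonroot (K : numDomainType) (p : {poly K}) :
  p != 0 -> exists t, ~~ root p t.
Proof.
(* These are [size p] distinct points, one more than the degree of [p]. *)
move=> p0; pose rs : seq K := [seq i%:R | i <- iota 0 (size p)].
have [/(max_poly_roots p0)|] := boolP (all (root p) rs); last first.
  by case/allPn => t _ pt; exists t.
rewrite map_inj_uniq ?iota_uniq; last exact: (mulrIn (oner_neq0 K)).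
by rewrite size_map size_iota ltnn => /(_ isT).
Qed.

(* The entries of [w C] for [w = (1, t, t^2, ...)] are polynomials in [t]; pick
   [t] off the finitely many roots of the nonzero ones. *)
Lemma exists_row_mulmx_neq0 (K : numDomainType) k n (C : 'M[K]_(k, n)) :
  exists w : 'rV_k, forall j, col j C != 0 -> (w *m C) 0 j != 0.
Proof.
pose p j : {poly K} := \sum_i C i j *: 'X^i.
have p_neq0 j : col j C != 0 -> p j != 0.
  apply: contra => /eqP pj0; apply/eqP/matrixP => i l; rewrite !mxE.
  have := congr1 (fun q : {poly K} => q`_i) pj0; rewrite coef0 coef_sum.
  rewrite (bigD1 i) //= coefZ coefXn eqxx mulr1 big1 ?addr0 // => m mi.
  by rewrite coefZ coefXn -(inj_eq val_inj) eq_sym in mi *; rewrite (negPf mi) mulr0.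
have [|t] := @exists_nonroot _ (\prod_(j | col j C != 0) p j).
  by apply/prodf_neq0 => j; apply: p_neq0.
rewrite rootE horner_prod => /prodf_neq0 pt; exists (\row_i t ^+ i) => j /pt.
rewrite horner_sum mxE; congr (_ != _); apply: eq_bigr => i _.
by rewrite hornerZ hornerXn mxE mulrC.
Qed.

(** * Quadratic forms of both sides as traces *)

Section SchurForm.
Variable R : realType.

(** Both sides expand to one double sum; the trace form replaces the entrywise product by ordinary
    products, so that cyclicity applies. *)
Lemma schur_prod_form n (x : 'rV[R[i]]_n) (X Y : 'M[R[i]]_n) :
  (x *m schur_prod X Y *m x^t*) 0 0 =
  \tr (diag_mx x *m X *m (diag_mx x)^t* *m Y^T).
Proof.
rewrite tr_diag_mx map_diag_mx.
have -> : \tr (diag_mx x *m X *m diag_mx (map_mx Num.conj x) *m Y^T) =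
    \sum_i \sum_j x 0 i * X i j * (x 0 j)^* * Y i j.
  apply: eq_bigr => i _; rewrite mxE; apply: eq_bigr => j _.
  by rewrite mul_mx_diag mul_diag_mx !mxE.
rewrite exchange_big mxE; apply: eq_bigr => j _; rewrite !mxE mulr_suml.
by apply: eq_bigr => i _; rewrite !mxE !mulrA mulrAC.
Qed.

(** The transpose of [B *m B^t*] is [(B^T)^t* *m B^T]; rotating its right factor to the front of the
    trace assembles [M] and its adjoint. *)
Lemma schur_lhs_form k n a (C : 'M[R[i]]_(k, n)) (A B : 'M_(n, a)) (v : 'rV_k) :
  let M := sandwich A B (v *m C) in
  (v *m schur_lhs C A B *m v^t*) 0 0 = \tr (M *m M^t*).
Proof.
move=> M; rewrite /schur_lhs; set H := schur_prod _ _.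
have -> : v *m (C *m H *m C^t*) *m v^t* = (v *m C) *m H *m (v *m C)^t*.
  by rewrite adjmx_mul !mulmxA.
have BE : (B^T)^t* = (B^t*)^T by apply/matrixP => i j; rewrite !mxE.
rewrite schur_prod_form trmx_mul mxtrace_mulC -mulmxA mxtrace_mulC /M /sandwich.
by rewrite !adjmx_mul BE !mulmxA.
Qed.

(** With [x = v *m C], the scalar [x *m d] is the trace of [diag_mx x *m A *m B^T], and the trace is
    cyclic. *)
Lemma schur_rhs_form k n a (C : 'M[R[i]]_(k, n)) (A B : 'M_(n, a)) (v : 'rV_k) :
  (v *m schur_rhs C A B *m v^t*) 0 0 =
  `|\tr (sandwich A B (v *m C))| ^+ 2.
Proof.
rewrite /schur_rhs /sandwich; set d := diag_col _.
have -> : v *m (C *m d *m d^t* *m C^t*) *m v^t* = (v *m C *m d) *m (v *m C *m d)^t*.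
  by rewrite !adjmx_mul !mulmxA.
rewrite -trace_mx11 mxtrace_gramE !big_ord1.
rewrite -[in RHS]mulmxA mxtrace_mulC -[in RHS]mulmxA.
congr (`|_| ^+ 2); rewrite mxE; apply: eq_bigr => i _.
by rewrite mul_diag_mx !mxE.
Qed.

Lemma schur_prod_adj n (X Y : 'M[R[i]]_n) :
  X^t* = X -> Y^t* = Y -> (schur_prod X Y)^t* = schur_prod X Y.
Proof.
by move=> {2}<- {2}<-; apply/matrixP => i j; rewrite !mxE rmorphM.
Qed.

Lemma schur_lhs_adj k n a (C : 'M[R[i]]_(k, n)) (A B : 'M_(n, a)) :
  (schur_lhs C A B)^t* = schur_lhs C A B.
Proof.
rewrite /schur_lhs !adjmx_mul trmxCK mulmxA schur_prod_adj //.
  by rewrite adjmx_mul trmxCK.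
by rewrite adjmx_mul trmxCK.
Qed.

Lemma schur_rhs_adj k n a (C : 'M[R[i]]_(k, n)) (A B : 'M_(n, a)) :
  (schur_rhs C A B)^t* = schur_rhs C A B.
Proof. by rewrite /schur_rhs /= !adjmx_mul !trmxCK !mulmxA. Qed.

Lemma rank_schur_rhs k n a (C : 'M[R[i]]_(k, n)) (A B : 'M_(n, a)) :
  (\rank (schur_rhs C A B) <= 1)%N.
Proof.
rewrite /schur_rhs /= -!mulmxA mulmxA.
exact: leq_trans (mxrankM_maxl _ _) (rank_leq_col _).
Qed.

(** A principal submatrix of a Gram matrix is the Gram matrix of the selected rows. *)
Lemma rank_gram_on n a (J : {set 'I_n}) (A : 'M[R[i]]_(n, a)) :
  \rank (gram_on J A) = \rank (rows_on J A).
Proof.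
rewrite -[RHS]rank_gram /gram_on /principal_submx mxsub_mul.
by rewrite -map_mxsub -trmx_mxsub.
Qed.

Lemma gamma_real n a (A B : 'M[R[i]]_(n, a)) J : gamma A B J \is Num.real.
Proof. by rewrite realV realn. Qed.

Lemma schur_form k n a (C : 'M[R[i]]_(k, n)) (A B : 'M_(n, a)) c (v : 'rV_k) :
  let M := sandwich A B (v *m C) in
  (v *m (schur_lhs C A B - c *: schur_rhs C A B) *m v^t*) 0 0 =
  \tr (M *m M^t*) - c * `|\tr M| ^+ 2.
Proof.
rewrite mulmxBr mulmxBl -scalemxAr -scalemxAl /= -schur_lhs_form -schur_rhs_form.
rewrite [LHS]mxE; congr (_ + _).
by rewrite [LHS]mxE; congr (- _); rewrite [LHS]mxE.
Qed.

Lemma loewner_ge_schur_trace k n a (C : 'M[R[i]]_(k, n)) (A B : 'M_(n, a)) c :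
  loewner_ge (schur_lhs C A B) (c *: schur_rhs C A B) ->
  forall v : 'rV_k, c * `|\tr (sandwich A B (v *m C))| ^+ 2 <=
    \tr (sandwich A B (v *m C) *m (sandwich A B (v *m C))^t*).
Proof.
move=> /hermitian_eigen_ge0P[_ +] v => /(_ v).
by rewrite schur_form subr_ge0.
Qed.

(** Realness of [c] makes the difference of the two sides Hermitian. *)
Lemma trace_loewner_ge_schur k n a (C : 'M[R[i]]_(k, n)) (A B : 'M_(n, a)) c :
  c \is Num.real ->
  (forall v : 'rV_k, c * `|\tr (sandwich A B (v *m C))| ^+ 2 <=
    \tr (sandwich A B (v *m C) *m (sandwich A B (v *m C))^t*)) ->
  loewner_ge (schur_lhs C A B) (c *: schur_rhs C A B).
Proof.
move=> c_real le_c; apply/hermitian_eigen_ge0P; split=> [|v].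
  by rewrite adjmx_subZ (CrealP c_real) schur_lhs_adj schur_rhs_adj.
by rewrite schur_form subr_ge0.
Qed.

End SchurForm.

(** * Extremal matrices and the theorem *)

Lemma rows_on_extend (K : comNzRingType) n a (J : {set 'I_n}) (A : 'M[K]_(#|J|, a)) :
  rows_on J ((rows_on J 1%:M)^T *m A) = A.
Proof.
apply/matrixP => s l; rewrite !mxE (bigD1 s) //= !mxE eqxx mul1r.
rewrite big1 ?addr0 // => t ts.
by rewrite !mxE (inj_eq enum_val_inj) (negPf ts) mul0r.
Qed.

Lemma mxtrace_pid (K : comNzRingType) n r :
  (r <= n)%N -> \tr (pid_mx r : 'M[K]_n) = r%:R.
Proof.
move=> rn; rewrite -(subnKC rn) pid_mx_block mxtrace_block mxtrace1.
by rewrite mxtrace0 addr0.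
Qed.

Lemma mulmx_diag_inv (K : fieldType) n (y : 'rV[K]_n) :
  (forall i, y 0 i != 0) -> diag_mx y *m diag_mx (\row_i (y 0 i)^-1) = 1%:M.
Proof.
move=> y0; rewrite mulmx_diag; apply/matrixP => i j; rewrite !mxE.
by rewrite divff.
Qed.

Theorem theorem1p18 (R : realType) (n k : nat) (hn : (1 <= n)%N)
    (hk : (1 <= k)%N) (C : 'M[R[i]]_(k, n)) :
  let J := nonzero_cols C in
  (* the lower bound, by a matrix of rank at most one *)
  (forall (a : nat) (A B : 'M[R[i]]_(n, a)), (1 <= a)%N ->
     gram_on J A != 0 -> gram_on J B != 0 ->
     loewner_ge (schur_lhs C A B) (gamma A B J *: schur_rhs C A B) /\
     (\rank (gamma A B J *: schur_rhs C A B) <= 1)%N) /\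
  (* gamma is best possible, for every admissible pair of ranks *)
  (forall a p q : nat, (1 <= a)%N ->
     (1 <= p <= minn #|J| a)%N -> (1 <= q <= minn #|J| a)%N ->
     exists A B : 'M[R[i]]_(n, a),
       [/\ \rank (gram_on J A) = p, \rank (gram_on J B) = q &
           forall c : R[i],
             loewner_ge (schur_lhs C A B) (c *: schur_rhs C A B) ->
             c <= gamma A B J]).
Proof.
move=> J.
have supp (v : 'rV_k) i : i \notin J -> (v *m C) 0 i = 0.
  rewrite inE negbK => /eqP Ci0.
  have -> : (v *m C) 0 i = (v *m col i C) 0 0.
    by rewrite !mxE; apply: eq_bigr => j _; rewrite mxE.
  by rewrite Ci0 mulmx0 mxE.
split=> [a A B _ A0 B0|a p q _].
  split; last exact: leq_trans (mxrank_scale _ _) (rank_schur_rhs _ _ _).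
  apply: trace_loewner_ge_schur => [|v]; first exact: gamma_real.
  set M := sandwich _ _ _; rewrite /gamma; set r := minn _ _.
  have r_gt0 : (0 : R[i]) < r%:R.
    rewrite ltr0n leq_min !lt0n.
    by rewrite (mxrank_eq0 (gram_on J A)) A0 mxrank_eq0 B0.
  rewrite mulrC ler_pdivrMr // mulrC.
  apply: le_trans (norm_mxtrace_sqr_le M) _.
  apply: ler_wpM2r; first exact: mxtrace_gram_ge0.
  rewrite ler_nat leq_min !rank_gram_on /M (sandwich_rows_on _ _ (supp v)).
  rewrite /sandwich; apply/andP; split; first exact: mxrankM_maxr.
  by rewrite -mulmxA -[leqRHS]mxrank_tr mxrankM_maxl.
rewrite !leq_min => /and3P[p0 pJ pa] /and3P[q0 qJ qa].
have [w wC] := exists_row_mulmx_neq0 C.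
pose y : 'rV_#|J| := colsub enum_val (w *m C).
have y0 s : y 0 s != 0.
  by rewrite mxE wC //; have := enum_valP s; rewrite inE.
(* [S^T] extends by zero outside [J]. On [J], the inverse of [diag_mx y] built into [B] cancels the
   weights of [w *m C], leaving [pid_mx q *m pid_mx p]. *)
pose S : 'M[R[i]]_(#|J|, n) := rows_on J 1%:M.
pose A : 'M[R[i]]_(n, a) := S^T *m pid_mx p.
pose B : 'M[R[i]]_(n, a) := S^T *m (diag_mx (\row_s (y 0 s)^-1) *m pid_mx q).
have dy := mulmx_diag_inv y0.
have rA : \rank (gram_on J A) = p.
  by rewrite rank_gram_on rows_on_extend rank_pid_mx.
have rB : \rank (gram_on J B) = q.
  rewrite rank_gram_on rows_on_extend eqmxMfull ?rank_pid_mx //.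
  by rewrite row_full_unit; case/mulmx1_unit: dy.
have MAB : sandwich A B (w *m C) = pid_mx (minn p q).
  rewrite (sandwich_rows_on _ _ (supp w)) !rows_on_extend /sandwich trmx_mul.
  rewrite tr_diag_mx tr_pid_mx -(mulmxA (pid_mx q)) diag_mxC dy mulmx1 mul_pid_mx.
  by congr pid_mx; lia.
exists A, B; split=> // c /loewner_ge_schur_trace/(_ w).
(* For this coordinate projection, the trace and the squared Frobenius norm both equal [r], so the
   inequality reads [c * r^2 <= r]. *)
rewrite MAB tr_pid_mx map_pid_mx mul_pid_mx /gamma rA rB.
set r := minn p q.
have -> : minn a (minn r r) = r by lia.
have r_gt0 : (0 : R[i]) < r%:R by rewrite ltr0n leq_min p0.
rewrite mxtrace_pid; last by lia.
by rewrite normr_nat expr2 mulrA ger_pMl // -ler_pdivlMr // div1r.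
Qed.
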